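(* Let $\mathcal P_1,\ldots,\mathcal P_n$ be ranked posets. Whenever the respective constructions are defined, the following are equivalent: (1) $\bigsqcup_{i=1}^n\underline{\mathcal P_i}$ is Macaulay; (2) $\bigvee_{i=1}^n\mathcal P_i$ is Macaulay; (3) $\Diamond_{i=1}^n\widehat{\mathcal P_i}$ is Macaulay. That is: if every $\mathcal P_i$ has a unique least element, then (1) and (2) are equivalent; if moreover all maximal elements of all the $\mathcal P_i$ have one common rank, then (1), (2) and (3) are equivalent. Moreover, whenever the respective constructions are defined, (1')$\Rightarrow$(2')$\Rightarrow$(3'), where (1') $\bigsqcup_{i=1}^n\mathcal P_i$ is Macaulay; (2') $\bigvee_{i=1}^n\mathcal P_i$ is Macaulay; (3') $\Diamond_{i=1}^n\mathcal P_i$ is Macaulay. That is: (1')$\Rightarrow$(2') if every $\mathcal P_i$ has a unique least element; (2')$\Rightarrow$(3') if every $\mathcal P_i$ has a unique least and a unique largest element and all $\mathcal P_i$ have the same rank.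
   Context: A poset $\mathcal P$ is ranked if there is a function $r:\mathcal P\to\mathbb N=\{0,1,\dots\}$ such that some minimal element has rank $0$ and $r(b)=r(a)+1$ whenever $b$ covers $a$. The rank of $\mathcal P$ is the largest rank of an element; $\mathcal P_{[d]}$ is the set of elements of rank $d$. Levels are assumed finite. For $A\subseteq\mathcal P$ the upper shadow is $\nabla_{\mathcal P}A=\{b\in\mathcal P: b\text{ covers some }a\in A\}$. Given an additional total order on $\mathcal P$ (not required to be related to the partial order), $\mathrm{Seg}_d\,q$ is the set of the $q$ largest elements of $\mathcal P_{[d]}$ in the total order. $\mathcal P$ is Macaulay if there is a total order such that for every $d$ and every $A\subseteq\mathcal P_{[d]}$: (i) $|\nabla\mathrm{Seg}_d|A||\le|\nabla A|$, and (ii) $\nabla\mathrm{Seg}_d|A|=\mathrm{Seg}_{d+1}|\nabla\mathrm{Seg}_d|A||$. (The empty poset is vacuously Macaulay.) $\underline{\mathcal P}$ is $\mathcal P$ with its unique smallest element removed (ranks shifted down by one). $\widehat{\mathcal P}$ is $\mathcal P$ with a new element added that is larger than all elements of $\mathcal P$. The disjoint union $\bigsqcup\mathcal P_i$ has $a\le b$ iff $a,b$ lie in the same $\mathcal P_i$ and $a\le b$ there. The wedge product $\bigvee\mathcal P_i$ (for posets with unique least elements) is the disjoint union with all least elements identified to one element. The diamond product $\Diamond\mathcal P_i$ (for ranked posets of the same rank with unique least and unique largest elements) is the disjoint union with all least elements identified to one element and all largest elements identified to another. In the last two, $a\le b$ iff $a\le b$ in some $\mathcal P_i$. Ranks in all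 these posets are inherited from the $\mathcal P_i$.
   Formalization: The rank function is also required to be strictly increasing along the order (automatic for finite posets and whenever comparable elements are joined by saturated chains); without this, (1)⇒(2) fails for some infinite posets with dense parts. *)

(* Defs.v *)
From HB Require Import structures.
From mathcomp Require Import all_boot all_order.
From mathcomp Require Import finmap.
From mathcomp Require Import boolp classical_sets cardinality.

Set Implicit Arguments.
Unset Strict Implicit.
Unset Printing Implicit Defensive.

Import Order.TTheory.

Local Open Scope classical_set_scope.
Local Open Scope order_scope.
Local Open Scope quotient_scope.

(* Size of a finite set; all the sets it is applied to below lie in a level. *)
Definition card (T : choiceType) (A : set T) : nat := #|` fset_set A |%fset.

Section Macaulay.
Variables (disp : Order.disp_t) (T : porderType disp).
Implicit Types (a b x y : T) (r : T -> nat) (A : set T) (d q : nat).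

Definition covers b a : Prop := a < b /\ (forall c, a < c -> ~ c < b).

Definition minimal x : Prop := forall y, y <= x -> y = x.

Definition maximal x : Prop := forall y, x <= y -> y = x.

Definition level r d : set T := [set x | r x = d].

(* Strict monotonicity follows from the covering condition when any two       *)
(* comparable elements are joined by a saturated chain (for instance when T   *)
(* is finite); it rules out orders, such as dense ones, in which the covering *)
(* condition carries little or no information.                                *)
Definition ranked r : Prop :=
  [/\ exists2 x, minimal x & r x = 0%N,
      forall a b, covers b a -> r b = (r a).+1,
      {homo r : a b / a < b >-> (a < b)%N}
    & forall d, finite_set (level r d)].

Definition has_rank r d : Prop := (exists x, r x = d) /\ (forall x, (r x <= d)%N).

Definition upper_shadow A : set T := [set b | exists2 a, A a & covers b a].

Definition total_order (R : rel T) : Prop :=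
  [/\ reflexive R, antisymmetric R, transitive R & total R].

(* An element is among the q largest of its level when fewer than q elements  *)
(* of the level are strictly larger.                                          *)
Definition Seg (R : rel T) r d q : set T :=
  [set x | level r d x /\
           (card [set y | [/\ level r d y, R x y & y <> x]] < q)%N].

Definition Macaulay r : Prop :=
  exists2 R : rel T, total_order R &
    forall d A, A `<=` level r d ->
      (card (upper_shadow (Seg R r d (card A))) <= card (upper_shadow A))%N /\
      upper_shadow (Seg R r d (card A)) =
        Seg R r d.+1 (card (upper_shadow (Seg R r d (card A)))).

End Macaulay.

Section Underline.
Variables (disp : Order.disp_t) (T : bPOrderType disp).

Definition underline := {x : T | x != \bot}.

HB.instance Definition _ := SubChoice.on underline.
HB.instance Definition _ :=
  [SubChoice_isSubPOrder of underline by <: with disp].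

Definition underline_rank (r : T -> nat) (x : underline) : nat := (r (val x)).-1.

End Underline.

Section Hat.
Variables (disp : Order.disp_t) (T : bPOrderType disp).

(* None is the added largest element. *)
Definition hat := option T.

HB.instance Definition _ := Choice.on hat.

Definition hat_le (u v : hat) : bool :=
  match u, v with
  | _, None => true
  | None, Some _ => false
  | Some x, Some y => x <= y
  end.

Lemma hat_le_refl : reflexive hat_le.
Proof. by case=> //= x. Qed.

Lemma hat_le_anti : antisymmetric hat_le.
Proof. by case=> [x|] [y|] //= /le_anti ->. Qed.

Lemma hat_le_trans : transitive hat_le.
Proof. by case=> [y|] [x|] [z|] //=; apply: le_trans. Qed.

HB.instance Definition _ :=
  Order.Le_isPOrder.Build disp hat hat_le_refl hat_le_anti hat_le_trans.

Lemma hat_le0x (u : hat) : (Some \bot : hat) <= u.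
Proof. by case: u => //= x; apply: le0x. Qed.

Lemma hat_lex1 (u : hat) : u <= (None : hat).
Proof. by case: u. Qed.

HB.instance Definition _ := Order.hasBottom.Build disp hat hat_le0x.
HB.instance Definition _ := Order.hasTop.Build disp hat hat_lex1.

(* d is the rank of T. *)
Definition hat_rank (r : T -> nat) (d : nat) (u : hat) : nat :=
  if u is Some x then r x else d.+1.

End Hat.

(* The relation on W carried over from the orders of the P i along maps       *)
(* f i : P i -> W: u <= v iff u and v come from some x <= y in the same P i.  *)
Definition family_le (disp : Order.disp_t) (I : Type) (P : I -> porderType disp)
    (W : Type) (f : forall i, P i -> W) : rel W :=
  fun u v => `[< exists i (x y : P i), [/\ u = f i x, v = f i y & x <= y] >].

Section DisjointUnion.
Variables (disp : Order.disp_t) (I : choiceType) (P : I -> porderType disp).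

Definition dunion := {i : I & P i}.

HB.instance Definition _ := Choice.on dunion.

Definition dunion_in i (x : P i) : dunion := Tagged (fun i => P i) x.

Definition dunion_le : rel dunion := family_le dunion_in.

Lemma dunion_le_refl : reflexive dunion_le.
Proof. by case=> i x; apply/asboolP; exists i, x, x. Qed.

Lemma dunion_le_anti : antisymmetric dunion_le.
Proof.
move=> u v /andP[/asboolP[i [x [y [-> -> xy]]]]].
move=> /asboolP[j [y' [x' [e1 e2 yx]]]].
have eij : i = j by have := congr1 tag e1.
move: y' x' e1 e2 yx; rewrite -eij => y' x' /eqP.
rewrite eq_Tagged => /eqP /= <- /eqP; rewrite eq_Tagged => /eqP /= <- yx.
by congr dunion_in; apply: le_anti; rewrite xy.
Qed.

Lemma dunion_le_trans : transitive dunion_le.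
Proof.
move=> v u w /asboolP[i [x [y [-> -> xy]]]] /asboolP[j [y' [z [e -> yz]]]].
have eij : i = j by have := congr1 tag e.
move: y' z e yz; rewrite -eij => y' z /eqP.
rewrite eq_Tagged => /eqP /= <- yz; apply/asboolP; exists i, x, z.
by split=> //; apply: le_trans yz.
Qed.

HB.instance Definition _ :=
  Order.Le_isPOrder.Build disp dunion
    dunion_le_refl dunion_le_anti dunion_le_trans.

Definition dunion_rank (r : forall i, P i -> nat) (u : dunion) : nat :=
  r (tag u) (tagged u).

End DisjointUnion.

(* The quotient of the disjoint union in which any two points carrying the    *)
(* same label Some b are identified.                                          *)
Section Glue.
Variables (disp : Order.disp_t) (I : choiceType) (P : I -> porderType disp).
Variable lab : forall i, P i -> option bool.

Definition same_label : rel (dunion P) := fun u v =>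
  (u == v) || ((lab (tagged u) != None) && (lab (tagged u) == lab (tagged v))).

Lemma same_label_refl : reflexive same_label.
Proof. by move=> u; rewrite /same_label eqxx. Qed.

Lemma same_label_sym : symmetric same_label.
Proof.
move=> u v; rewrite /same_label (eq_sym v); congr (_ || _).
by apply/andP/andP => -[nu /eqP <-].
Qed.

Lemma same_label_trans : transitive same_label.
Proof.
move=> v u w /orP[/eqP -> //|/andP[nu /eqP euv]] /orP[/eqP <-|/andP[nv evw]].
  by rewrite /same_label nu euv eqxx orbT.
by rewrite /same_label nu euv evw orbT.
Qed.

Canonical same_label_equiv :=
  EquivRel same_label same_label_refl same_label_sym same_label_trans.

Definition glue := {eq_quot same_label}.

Definition glue_in i (x : P i) : glue := \pi_glue (dunion_in x).

Definition glue_le : rel glue := family_le glue_in.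

Lemma glue_inP (u : glue) : exists i (x : P i), u = glue_in x.
Proof.
exists (tag (repr u)), (tagged (repr u)); rewrite -[LHS]reprK /glue_in.
by case: (repr u).
Qed.

Lemma glue_in_eq i (x : P i) j (y : P j) :
  glue_in x = glue_in y ->
  dunion_in x = dunion_in y \/ lab x <> None /\ lab x = lab y.
Proof.
move=> /eqquotP/orP[/eqP|/andP[/eqP nx /eqP exy]]; first by left.
by right.
Qed.

Hypothesis lab_least : forall i (x : P i), lab x = Some false -> forall y, x <= y.
Hypothesis lab_greatest : forall i (x : P i), lab x = Some true -> forall y, y <= x.

Lemma glue_le_refl : reflexive glue_le.
Proof. by move=> u; have [i [x ->]] := glue_inP u; apply/asboolP; exists i, x, x. Qed.

Lemma glue_in_inj i (x y : P i) : glue_in x = glue_in y -> x = y.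
Proof.
move=> /glue_in_eq[/eqP|]; first by rewrite eq_Tagged => /eqP.
case ex: (lab x) => [[]|] [_ /esym ey] //; apply: le_anti.
- by rewrite (lab_greatest ex) (lab_greatest ey).
- by rewrite (lab_least ex) (lab_least ey).
Qed.

Lemma glue_le_anti : antisymmetric glue_le.
Proof.
move=> u v /andP[/asboolP[i [x [y [eu ev xy]]]]].
move=> /asboolP[j [y' [x' [ev' eu' yx]]]].
have := ev; rewrite {1}ev' => /glue_in_eq[e|[nl]].
  have eij : j = i by have := congr1 tag e.
  move: y' x' e yx {ev'} eu'; rewrite eij => y' x' /eqP.
  rewrite eq_Tagged => /eqP /= -> yx eu'.
  have exx : x = x' by apply: glue_in_inj; rewrite -eu.
  by rewrite eu ev; congr glue_in; apply: le_anti; rewrite xy exx.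
case ey': (lab y') nl => [[]|] // _ /esym ey.
- by rewrite ev' eu'; congr glue_in; apply: le_anti; rewrite yx (lab_greatest ey').
- by rewrite ev eu; congr glue_in; apply: le_anti; rewrite xy (lab_least ey).
Qed.

Lemma glue_le_trans : transitive glue_le.
Proof.
move=> v u w /asboolP[i [x [y [eu ev xy]]]] /asboolP[j [y' [z [ev' ew yz]]]].
have := ev; rewrite {1}ev' => /glue_in_eq[e|[nl]].
  have eij : j = i by have := congr1 tag e.
  move: y' z e yz {ev'} ew; rewrite eij => y' z /eqP.
  rewrite eq_Tagged => /eqP /= -> yz ew; apply/asboolP; exists i, x, z.
  by split=> //; apply: le_trans yz.
case ey': (lab y') nl => [[]|] // _ /esym ey.
- apply/asboolP; exists i, x, y; split=> //; rewrite ew -ev ev'.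
  by congr glue_in; apply: le_anti; rewrite yz (lab_greatest ey').
- apply/asboolP; exists j, y', z; split=> //; rewrite eu -ev' ev.
  by congr glue_in; apply: le_anti; rewrite xy (lab_least ey).
Qed.

(* Evaluated on a chosen representative; this does not depend on the choice   *)
(* as soon as r is constant on the points carrying a given label.             *)
Definition glue_rank (r : forall i, P i -> nat) (u : glue) : nat :=
  dunion_rank r (repr u).

Lemma glue_rankE (r : forall i, P i -> nat) i (x : P i) :
  (forall j (y : P j) k (z : P k), lab y <> None -> lab y = lab z -> r j y = r k z) ->
  glue_rank r (glue_in x) = r i x.
Proof.
move=> hr; rewrite /glue_rank -[RHS]/(dunion_rank r (dunion_in x)).
have /glue_in_eq[|[nl el]] : @glue_in (tag (repr (glue_in x)))
    (tagged (repr (glue_in x))) = glue_in x.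
- by rewrite -[RHS]reprK {1}/glue_in; case: (repr (glue_in x)).
- by case: (repr _) => j y /= <-.
- exact: hr nl el.
Qed.

End Glue.

Section Wedge.
Variables (disp : Order.disp_t) (I : choiceType) (P : I -> bPOrderType disp).

Definition wedge_label i (x : P i) : option bool :=
  if x == \bot then Some false else None.

Lemma wedge_label_least i (x : P i) :
  wedge_label x = Some false -> forall y, x <= y.
Proof. by rewrite /wedge_label; case: eqP => // -> _ y; apply: le0x. Qed.

Lemma wedge_label_greatest i (x : P i) :
  wedge_label x = Some true -> forall y, y <= x.
Proof. by rewrite /wedge_label; case: eqP. Qed.

Definition wedge := glue wedge_label.

HB.instance Definition _ := Choice.on wedge.
HB.instance Definition _ :=
  Order.Le_isPOrder.Build disp wedge
    (@glue_le_refl _ _ _ wedge_label)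
    (glue_le_anti wedge_label_least wedge_label_greatest)
    (glue_le_trans wedge_label_least wedge_label_greatest).

Definition wedge_rank (r : forall i, P i -> nat) (u : wedge) : nat :=
  glue_rank r u.

End Wedge.

(* When some P i has a single element, its label is that of the least         *)
(* elements; among posets of the same rank this only happens when all the     *)
(* P i have a single element, and their diamond product then has one too.     *)
Section Diamond.
Variables (disp : Order.disp_t) (I : choiceType) (P : I -> tbPOrderType disp).

Definition diamond_label i (x : P i) : option bool :=
  if x == \bot then Some false else if x == \top then Some true else None.

Lemma diamond_label_least i (x : P i) :
  diamond_label x = Some false -> forall y, x <= y.
Proof.
rewrite /diamond_label; case: eqP => [-> _ y|_]; first exact: le0x.
by case: ifP.
Qed.

Lemma diamond_label_greatest i (x : P i) :
  diamond_label x = Some true -> forall y, y <= x.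
Proof.
by rewrite /diamond_label; case: eqP => // _; case: eqP => // -> _ y; apply: lex1.
Qed.

Definition diamond := glue diamond_label.

HB.instance Definition _ := Choice.on diamond.
HB.instance Definition _ :=
  Order.Le_isPOrder.Build disp diamond
    (@glue_le_refl _ _ _ diamond_label)
    (glue_le_anti diamond_label_least diamond_label_greatest)
    (glue_le_trans diamond_label_least diamond_label_greatest).

Definition diamond_rank (r : forall i, P i -> nat) (u : diamond) : nat :=
  glue_rank r u.

End Diamond.

(* Main.v *)
(* Being Macaulay is a condition on each pair of consecutive levels, once the
   total order is fixed.  At a pair of consecutive levels the posets compared
   here either are isomorphic, or every element of the lower level lies below
   every element of the upper one, in which case the condition is automatic.
   The latter happens only at the glued least elements and at the glued
   largest elements, and these single points are also the only ones about
   which a total order carried over from one poset to the other is not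
   already prescribed. *)
From HB Require Import structures.
From mathcomp Require Import all_boot all_order.
From mathcomp Require Import finmap.
From mathcomp Require Import boolp classical_sets functions cardinality.
Require Import Defs.

Set Implicit Arguments.
Unset Strict Implicit.
Unset Printing Implicit Defensive.

Import Order.TTheory.

Local Open Scope classical_set_scope.
Local Open Scope order_scope.

(** * Cardinalities of finite sets and greatest elements *)

Section Card.
Variables T U : choiceType.
Implicit Types A B : set T.

Lemma card_set0 : card (set0 : set T) = 0%N.
Proof. by rewrite /card fset_set0 cardfs0. Qed.

Lemma card_gt0 A : finite_set A -> A !=set0 -> (0 < card A)%N.
Proof.
move=> fA [x Ax]; rewrite /card cardfs_gt0; apply/fset0Pn; exists x.
by rewrite in_fset_set // inE.
Qed.

Lemma card_lt A B : finite_set B -> A `<` B -> (card A < card B)%N.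
Proof.
move=> fB [AB nBA]; have fA : finite_set A by apply: sub_finite_set fB.
apply: fproper_ltn_card; rewrite fproperEneq; apply/andP; split.
  by apply/eqP => /(fset_set_inj fA fB) e; apply: nBA; rewrite e.
by rewrite -fset_set_sub.
Qed.

Lemma card_inj_image (g : T -> U) A : finite_set A -> set_inj A g ->
  card (g @` A) = card A.
Proof.
move=> fA injg; rewrite /card fset_set_image //; apply: card_in_imfset => x y /=.
by rewrite !in_fset_set // => Ax Ay; apply: injg.
Qed.

End Card.

Lemma finite_set_greatest (T : choiceType) (R : rel T) (A : set T) :
  reflexive R -> transitive R -> total R -> finite_set A -> A !=set0 ->
  exists2 x, A x & forall y, A y -> R y x.
Proof.
move=> refR trR totR /finite_seqP[s ->] {A} [x0 /=].
elim: s x0 => [//|a s IHs] x0 _; case: s => [|b s] in IHs *.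
  by exists a => /= [|y]; rewrite inE // => /eqP ->.
have [x sx xmax] := IHs b (mem_head _ _).
have [ax|xa] := orP (totR a x).
  exists x; first by rewrite /= inE sx orbT.
  by move=> y; rewrite /= inE => /orP[/eqP ->|/xmax].
exists a; first by rewrite /= mem_head.
by move=> y; rewrite /= inE => /orP[/eqP ->//|/xmax yx]; apply: trR xa.
Qed.

(** * The Macaulay condition at one pair of consecutive levels *)

Section Level.
Variables (disp : Order.disp_t) (T : porderType disp).
Implicit Types (R : rel T) (r : T -> nat) (A : set T).

(** The part of [ranked] shared by all the posets built here, including empty ones (an empty family,
    or [underline] of a one-point poset), which have no minimal element of rank 0. *)
Definition graded r :=
  [/\ forall a b, covers b a -> r b = (r a).+1,
      {homo r : a b / a < b >-> (a < b)%N}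
    & forall d, finite_set (level r d)].

Definition Macaulay_at R r d := forall A, A `<=` level r d ->
  (card (upper_shadow (Seg R r d (card A))) <= card (upper_shadow A))%N /\
  upper_shadow (Seg R r d (card A)) =
    Seg R r d.+1 (card (upper_shadow (Seg R r d (card A)))).

Lemma ranked_graded r : ranked r -> graded r.
Proof. by case=> _ *; split. Qed.

(** Strict monotonicity of the rank leaves no room between consecutive levels, so there the shadow
    is read off from [<=] alone. *)
Lemma graded_covers r a b : graded r -> r b = (r a).+1 -> covers b a <-> a <= b.
Proof.
move=> [_ mr _] rb; split=> [[/ltW]//|ab]; split=> [|c ac cb].
  by rewrite lt_def ab andbT; apply/eqP => e; move: rb; rewrite e => /n_Sn.
by have := leq_ltn_trans (mr _ _ ac) (mr _ _ cb); rewrite rb ltnn.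
Qed.

Lemma upper_shadow_level r d A : graded r -> A `<=` level r d ->
  upper_shadow A `<=` level r d.+1.
Proof. by move=> [cr _ _] Ad b [a /Ad <- /cr]. Qed.

Lemma Seg_level R r d q : Seg R r d q `<=` level r d.
Proof. by move=> x []. Qed.

Lemma Seg_card_level R r d : reflexive R -> finite_set (level r d) ->
  Seg R r d (card (level r d)) = level r d.
Proof.
move=> refR fl; apply/seteqP; split=> [|x lx]; first exact: Seg_level.
split=> //; apply: card_lt => //; split=> [y []//|sub].
by have [_ _] := sub _ lx; apply.
Qed.

(** Here every nonempty subset of level [d] has the whole next level as its shadow, so both
    conditions reduce to the segment of a nonempty set being nonempty. *)
Lemma Macaulay_at_full R r d : total_order R -> graded r ->
  (forall x y, r x = d -> r y = d.+1 -> x <= y) -> Macaulay_at R r d.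
Proof.
move=> [refR asR trR totR] gr le_level A Ad; have [_ _ fl] := gr.
have [->|A0] := eqVneq A set0.
  have -> : Seg R r d (card (set0 : set T)) = set0.
    by apply/seteqP; split=> x // []; rewrite card_set0.
  have -> : upper_shadow (set0 : set T) = set0.
    by apply/seteqP; split=> x // [].
  by split=> //; apply/seteqP; split=> x // []; rewrite card_set0.
have full B : B `<=` level r d -> B !=set0 -> upper_shadow B = level r d.+1.
  move=> Bd [b Bb]; apply/seteqP; split=> [|x lx]; first exact: upper_shadow_level.
  exists b => //; have rb : r b = d := Bd _ Bb.
  rewrite (graded_covers gr) //; first exact: le_level.
  by rewrite rb.
have A0' : A !=set0 by apply/set0P.
have fA : finite_set A by apply: sub_finite_set (fl d).
have [|m lm mmax] := finite_set_greatest refR trR totR (fl d).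
  by case: A0' => a /Ad; exists a.
(* The greatest element of the level has nothing strictly above it, so it lies in every segment of
   positive size. *)
have Seg0 : Seg R r d (card A) !=set0.
  exists m; split=> //; have -> : [set y | [/\ level r d y, R m y & y <> m]] = set0.
    apply/seteqP; split=> y // [ly my]; apply; apply: asR.
    by rewrite mmax.
  by rewrite card_set0 card_gt0.
rewrite (full _ (@Seg_level _ _ _ _) Seg0) (full _ Ad A0').
by split=> //; rewrite Seg_card_level.
Qed.

End Level.

(** * Transfer of the condition along isomorphic pairs of levels *)

Section Transfer.
Variables (disp disp' : Order.disp_t) (T : porderType disp) (U : porderType disp').
Variables (r : T -> nat) (s : U -> nat) (R : rel T) (R' : rel U) (g : T -> U).
Hypotheses (gr : graded r) (gs : graded s).

(** Only the total orders are compared inside a level; the partial order matters between two levels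
    and is treated by [g_le]. *)
Definition level_iso d e := set_bij (level r d) (level s e) g /\
  forall x y, r x = d -> r y = d -> R' (g x) (g y) = R x y.

Lemma level_iso_card d e A : level_iso d e -> A `<=` level r d ->
  card (g @` A) = card A.
Proof.
move=> [[_ injg _] _] Ad; have [_ _ fl] := gr; apply: card_inj_image.
  exact: sub_finite_set (fl d).
by move=> x y /set_mem/Ad lx /set_mem/Ad ly; apply: injg; apply: mem_set.
Qed.

(** Membership in a segment depends only on how many elements of the level lie strictly above, and
    [g] preserves this number. *)
Lemma level_iso_Seg d e q : level_iso d e ->
  Seg R' s e q = g @` Seg R r d q.
Proof.
move=> iso; have [[fung injg surg] RE] := iso.
have upE x : level r d x -> [set u | [/\ level s e u, R' (g x) u & u <> g x]] =
    g @` [set y | [/\ level r d y, R x y & y <> x]].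
  move=> lx; apply/seteqP; split=> [u [/surg[y ly <-]]|u [y [ly xy nyx] <-]].
    by rewrite RE // => xy nyx; exists y => //; split=> // e'; apply: nyx; rewrite e'.
  by split; [exact: fung|rewrite RE|move=> /injg; rewrite !inE => /(_ ly lx)].
have cardE x : level r d x -> card [set u | [/\ level s e u, R' (g x) u & u <> g x]] =
    card [set y | [/\ level r d y, R x y & y <> x]].
  by move=> lx; rewrite upE // (level_iso_card iso) // => y [].
apply/seteqP; split=> [u [/surg[x lx <-]]|u [x [lx hx] <-]].
  by rewrite cardE // => hx; exists x.
by split; [exact: fung|rewrite cardE].
Qed.

Variables d e : nat.
Hypotheses (iso0 : level_iso d e) (iso1 : level_iso d.+1 e.+1).
Hypothesis g_le : forall x y, r x = d -> r y = d.+1 -> (g x <= g y) = (x <= y).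

Lemma level_iso_shadow A : A `<=` level r d ->
  upper_shadow (g @` A) = g @` upper_shadow A.
Proof.
move=> Ad; have [fun0 _ _] := iso0.1; have [fun1 inj1 sur1] := iso1.1.
have coversE x y : r x = d -> r y = d.+1 -> covers (g y) (g x) <-> covers y x.
  move=> rx ry; rewrite (graded_covers gr) ?(graded_covers gs) ?g_le ?rx //.
  by rewrite (fun0 _ rx) (fun1 _ ry).
have [cs _ _] := gs; apply/seteqP; split=> [v [_ [x Ax <-] cv]|_ [y [x Ax cy] <-]].
  have rx := Ad _ Ax; have := cs _ _ cv; rewrite (fun0 _ rx) => /sur1[y ly ev].
  by exists y => //; exists x => //; rewrite -coversE // ev.
exists (g x); first by exists x.
rewrite coversE //; first exact: Ad.
by apply: (upper_shadow_level gr Ad); exists x.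
Qed.

(** Subsets of the two levels correspond through images under [g], and this correspondence commutes
    with shadows, segments and cardinalities. *)
Lemma Macaulay_at_iso : Macaulay_at R r d <-> Macaulay_at R' s e.
Proof.
have [fun0 _ sur0] := iso0.1; have [_ inj1 _] := iso1.1.
have key A : A `<=` level r d ->
  ((card (upper_shadow (Seg R r d (card A))) <= card (upper_shadow A))%N /\
  upper_shadow (Seg R r d (card A)) =
    Seg R r d.+1 (card (upper_shadow (Seg R r d (card A))))) <->
  ((card (upper_shadow (Seg R' s e (card (g @` A)))) <= card (upper_shadow (g @` A)))%N /\
  upper_shadow (Seg R' s e (card (g @` A))) =
    Seg R' s e.+1 (card (upper_shadow (Seg R' s e (card (g @` A)))))).
  move=> Ad; rewrite (level_iso_card iso0) // (level_iso_Seg _ iso0).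
  rewrite !level_iso_shadow //; last exact: Seg_level.
  have Sd : Seg R r d (card A) `<=` level r d by exact: Seg_level.
  rewrite !(level_iso_card iso1) ?(level_iso_Seg _ iso1); try exact: upper_shadow_level.
  split=> -[le_c eS]; split=> //; first by rewrite -eS.
  (* Conversely, an equality of images under [g] pulls back to the sets themselves, because both lie
     in level [d.+1], where [g] is injective. *)
  have inS : upper_shadow (Seg R r d (card A)) `<=` level r d.+1.
    exact: upper_shadow_level.
  set q := card (upper_shadow _) in eS *.
  have inq : Seg R r d.+1 q `<=` level r d.+1 by exact: Seg_level.
  apply/seteqP; split=> x hx.
    have : (g @` Seg R r d.+1 q) (g x) by rewrite -eS; exists x.
    by move=> [y hy /inj1]; rewrite !inE => <- //; [exact: inq|exact: inS].
  have : (g @` upper_shadow (Seg R r d (card A))) (g x) by rewrite eS; exists x.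
  by move=> [y hy /inj1]; rewrite !inE => <- //; [exact: inS|exact: inq].
split=> mac B Bd; last first.
  apply/key => //; apply: mac => _ [x /Bd rx <-]; exact: fun0.
have -> : B = g @` (level r d `&` g @^-1` B).
  apply/seteqP; split=> [u Bu|_ [x [_ Bx] <-]//].
  by have [x rx gx] := sur0 _ (Bd _ Bu); exists x => //; split=> //=; rewrite gx.
by apply/key; [move=> x []|apply: mac => x []].
Qed.

End Transfer.

(** * Carrying total orders along a map *)

Section Order.
Variables (disp disp' : Order.disp_t) (T : porderType disp) (U : porderType disp').
Variable g : T -> U.

Lemma total_order_pull (R : rel U) : injective g -> total_order R ->
  total_order (fun x y => R (g x) (g y)).
Proof.
move=> injg [refR asR trR totR]; split=> [x|x y /asR/injg//|y x z|x y] //=.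
exact: trR.
Qed.

(** [R'] follows [R] on the image of [S] and puts every point outside this image on top. There is at
    most one such point, so antisymmetry survives. The partial map [h] inverts [g] on [S]. *)
Lemma total_order_push (R : rel T) (S : set T) : total_order R -> set_inj S g ->
  (forall u v, ~ (g @` S) u -> ~ (g @` S) v -> u = v) ->
  exists2 R' : rel U, total_order R' &
    forall x y, S x -> S y -> R' (g x) (g y) = R x y.
Proof.
move=> [refR asR trR totR] injg out.
have /choice[h hP] : forall u, exists o : option T,
    if o is Some x then S x /\ g x = u else ~ (g @` S) u.
  move=> u; have [[x Sx gx]|nu] := pselect ((g @` S) u); first by exists (Some x).
  by exists None.
exists (fun u v => match h u, h v with
  | _, None => true | None, Some _ => false | Some x, Some y => R x y end).
  split=> [u|u v|v u w|u v] /=.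
  - by case: (h u).
  - case: (h u) (h v) (hP u) (hP v) => [x|] [y|] // => [[_ <-] [_ <-] /asR ->//|nu nv _].
    exact: out.
  - by case: (h u) (h v) (h w) => [x|] [y|] [z|] //; apply: trR.
  - by case: (h u) (h v) => [x|] [y|].
have hg x : S x -> h (g x) = Some x.
  move=> Sx; have := hP (g x); case: (h (g x)) => [y [Sy /injg e]|[]]; last by exists x.
  by rewrite e // inE.
by move=> x y Sx Sy; rewrite !hg.
Qed.

End Order.

(** * Posets assembled from a finite family *)

Section Family.
Variables (disp disp' : Order.disp_t) (I : finType) (P : I -> porderType disp).
Variables (T : porderType disp').

(** What the disjoint union, the wedge and the diamond have in common, so that one transfer argument
    serves all three. Points of different [P i] may share an image, which leaves room for gluing. *)
Definition family_poset (f : forall i, P i -> T) (r : forall i, P i -> nat)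
    (rT : T -> nat) :=
  [/\ forall u, exists i (x : P i), u = f i x,
      forall i, injective (f i),
      forall u v, (u <= v) = family_le f u v
    & forall i x, rT (f i x) = r i x].

Lemma family_leW f r rT i (x y : P i) : family_poset f r rT -> x <= y -> f i x <= f i y.
Proof. by move=> [_ _ leE _] xy; rewrite leE; apply/asboolP; exists i, x, y. Qed.

(** A strict inequality lifts to a single [P i], and nothing can be inserted in the lifted pair
    unless it can be inserted below, since [f i] is strictly monotone. Each level is a finite union
    of images of finite levels. *)
Lemma family_graded f r rT : (forall i, graded (r i)) -> family_poset f r rT ->
  graded rT.
Proof.
move=> gr fam; have [surf injf leE rE] := fam.
have ltP u v : u < v -> exists i (x y : P i), [/\ u = f i x, v = f i y & x < y].
  rewrite lt_def leE => /andP[vu /asboolP[i [x [y [eu ev xy]]]]].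
  exists i, x, y; split=> //; rewrite lt_def xy andbT.
  by apply: contraNneq vu => exy; rewrite ev eu exy.
have ltW i (x y : P i) : x < y -> f i x < f i y.
  rewrite !lt_def => /andP[nxy xy]; rewrite (family_leW fam) // andbT.
  by apply: contraNneq nxy => /injf ->.
split=> [u v [/ltP[i [x [y [-> -> xy]]]] nb]|u v /ltP[i [x [y [-> -> xy]]]]|d].
- rewrite !rE; have [cr _ _] := gr i; apply: cr; split=> // c xc cy.
  by apply: nb (ltW _ _ _ xc) (ltW _ _ _ cy).
- by rewrite !rE; have [_ mr _] := gr i; apply: mr.
- have -> : level rT d = \bigcup_(i in [set: I]) f i @` level (r i) d.
    apply/seteqP; split=> [u|_ [i _ [x rx <-]]]; last by rewrite /level/= rE.
    by have [i [x ->]] := surf u; rewrite /level/= rE => rx; exists i => //; exists x.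
  apply: bigcup_finite; first exact: finite_finset.
  by move=> i _; apply: finite_image; have [_ _] := gr i; apply.
Qed.

End Family.

(** * Transfer between two posets assembled from families *)

Section FamilyTransfer.
Variables (dP dQ dT dU : Order.disp_t) (I : finType).
Variables (P : I -> porderType dP) (Q : I -> porderType dQ).
Variables (T : porderType dT) (U : porderType dU).
Variables (f : forall i, P i -> T) (r : forall i, P i -> nat) (rT : T -> nat).
Variables (h : forall i, Q i -> U) (s : forall i, Q i -> nat) (sU : U -> nat).
Variables (k : forall i, P i -> Q i) (g : T -> U).
Hypotheses (famP : family_poset f r rT) (famQ : family_poset h s sU).
Hypotheses (gr : forall i, graded (@r i)) (gs : forall i, graded (@s i)).
Hypothesis k_le : forall i (x y : P i), (k x <= k y) = (x <= y).
Hypothesis gE : forall i (x : P i), g (f x) = h (k x).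

(** Matching is tested inside each summand, where gluing is invisible; injectivity of [g] ensures
    that no two points of this level of [T] are merged in [U]. *)
Definition levels_match d e := set_inj (level rT d) g /\
  forall i, level (@s i) e = @k i @` level (@r i) d.

Lemma levels_match_iso R R' d e : levels_match d e ->
  (forall x y, rT x = d -> rT y = d -> R' (g x) (g y) = R x y) ->
  level_iso rT sU R R' g d e.
Proof.
move=> [injg lE] RE; have [surf _ _ rE] := famP; have [surh _ _ sE] := famQ.
split=> //; split=> // [x|u]; last first.
  have [i [y ->]] := surh u; rewrite /level/= sE => sy.
  have : level (@s i) e y by []. rewrite lE => -[x rx <-].
  by exists (f x) => //=; rewrite rE.
have [i [y ->]] := surf x; rewrite /level/= rE gE sE => ry.
by have : level (@s i) e (k y) by rewrite lE; exists y.
Qed.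

Lemma family_transfer R R' d e : levels_match d e -> levels_match d.+1 e.+1 ->
  (forall x y, (d <= rT x <= d.+1)%N -> (d <= rT y <= d.+1)%N ->
    R' (g x) (g y) = R x y) ->
  Macaulay_at R rT d <-> Macaulay_at R' sU e.
Proof.
move=> m0 m1 RE; have [surf _ leT rE] := famP; have [surh _ leU sE] := famQ.
have iso0 : level_iso rT sU R R' g d e.
  by apply: levels_match_iso => // x y rx ry; rewrite RE // ?rx ?ry leqnn leqnSn.
have iso1 : level_iso rT sU R R' g d.+1 e.+1.
  by apply: levels_match_iso => // x y rx ry; rewrite RE // ?rx ?ry leqnn leqnSn.
apply: (Macaulay_at_iso _ _ iso0 iso1).
- exact: family_graded gr famP.
- exact: family_graded gs famQ.
move=> x y rx ry; apply/idP/idP; last first.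
  rewrite leT => /asboolP[i [a [b [-> -> ab]]]]; rewrite !gE.
  by apply: family_leW famQ _; rewrite k_le.
have [fun0 inj0 _] := iso0.1; have [fun1 inj1 _] := iso1.1.
(* A comparison in [U] comes from a single [Q i]. Both ends lift through [k i] because the levels
   match, and injectivity of [g] identifies the lifts with [x] and [y]. *)
rewrite leU => /asboolP[i [p [q [ep eq pq]]]].
have : level (@s i) e p by rewrite /level/= -sE -ep; apply: fun0.
rewrite m0.2 => -[a ra ea].
have : level (@s i) e.+1 q by rewrite /level/= -sE -eq; apply: fun1.
rewrite m1.2 => -[b rb eb].
have -> : x = f a by apply: inj0; rewrite ?inE /level/= ?rE // gE ea.
have -> : y = f b by apply: inj1; rewrite ?inE /level/= ?rE // gE eb.
by apply: family_leW famP _; rewrite -k_le ea eb.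
Qed.

End FamilyTransfer.

(** * The three products as instances of [family_poset] *)

Section Products.
Variables (disp : Order.disp_t) (I : finType).

Lemma dunion_family (P : I -> porderType disp) (r : forall i, P i -> nat) :
  family_poset (@dunion_in disp I P) r (dunion_rank r).
Proof.
split=> //; first by case=> i x; exists i, x.
by move=> i x y /eqP; rewrite eq_Tagged => /eqP.
Qed.

Lemma wedge_labelE (P : I -> bPOrderType disp) i (x : P i) j (y : P j) :
  wedge_label x <> None -> wedge_label x = wedge_label y -> x = \bot /\ y = \bot.
Proof. by rewrite /wedge_label; case: eqP => // ->; case: eqP. Qed.

Lemma wedge_family (P : I -> bPOrderType disp) (r : forall i, P i -> nat) :
  (forall i j, r i \bot = r j \bot) ->
  family_poset (T := wedge P) (@glue_in _ _ _ (@wedge_label _ _ P)) r (wedge_rank r).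
Proof.
move=> rb; split=> //; first exact: glue_inP.
  by move=> i; apply: (glue_in_inj (@wedge_label_least _ _ P) (@wedge_label_greatest _ _ P)).
move=> i x; apply: glue_rankE => j y l z ny /(wedge_labelE ny)[-> ->]; exact: rb.
Qed.

Lemma diamond_labelE (P : I -> tbPOrderType disp) i (x : P i) j (y : P j) :
  diamond_label x <> None -> diamond_label x = diamond_label y ->
  x = \bot /\ y = \bot \/ x = \top /\ y = \top.
Proof.
rewrite /diamond_label; case: eqP => [->|_].
  by case: eqP => [->|_]; [left|case: eqP].
by case: eqP => // ->; case: eqP => // _; case: eqP => // ->; right.
Qed.

Lemma diamond_family (P : I -> tbPOrderType disp) (r : forall i, P i -> nat) :
  (forall i j, r i \bot = r j \bot) -> (forall i j, r i \top = r j \top) ->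
  family_poset (T := diamond P) (@glue_in _ _ _ (@diamond_label _ _ P)) r (diamond_rank r).
Proof.
move=> rb rt; split=> //; first exact: glue_inP.
  by move=> i; apply: (glue_in_inj (@diamond_label_least _ _ P) (@diamond_label_greatest _ _ P)).
move=> i x; apply: glue_rankE => j y l z ny /(diamond_labelE ny)[[-> ->]|[-> ->]].
  exact: rb.
exact: rt.
Qed.

End Products.

(** * Ranks of extreme elements, and of [underline] and [hat] *)

Section Ranks.
Variables (disp : Order.disp_t).

Lemma ranked_bot (P : bPOrderType disp) (r : P -> nat) : ranked r -> r \bot = 0%N.
Proof. by case=> [[x minx <-] _ _ _]; rewrite -(minx \bot (le0x x)). Qed.

Lemma ranked_eq0 (P : bPOrderType disp) (r : P -> nat) x : ranked r ->
  (r x == 0%N) = (x == \bot).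
Proof.
move=> rr; apply/eqP/eqP => [r0|->]; last exact: ranked_bot.
have [_ _ mr _] := rr; apply/eqP; apply: contraTT isT => x0.
have : \bot < x by rewrite lt_def x0 le0x.
by move=> /mr; rewrite r0.
Qed.

Lemma has_rank_top (P : tbPOrderType disp) (r : P -> nat) d : ranked r ->
  has_rank r d -> r \top = d.
Proof.
move=> [_ _ mr _] [[x rx] rle]; apply/eqP; rewrite eqn_leq rle -rx /=.
by have := lex1 x; rewrite le_eqVlt => /orP[/eqP ->//|/mr/ltnW].
Qed.

Lemma has_rank_eq_top (P : tbPOrderType disp) (r : P -> nat) d x : ranked r ->
  has_rank r d -> (r x == d) = (x == \top).
Proof.
move=> rr rd; apply/eqP/eqP => [rx|->]; last exact: has_rank_top.
have [_ _ mr _] := rr; apply/eqP; apply: contraTT isT => x1.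
have : x < \top by rewrite lt_def eq_sym x1 lex1.
by move=> /mr; rewrite rx (has_rank_top rr rd) ltnn.
Qed.

Lemma level_underline (P : bPOrderType disp) (r : P -> nat) d : ranked r ->
  level r d.+1 = (val : underline P -> P) @` level (underline_rank r) d.
Proof.
move=> rr; apply/seteqP; split=> [x rx|_ [x rx <-]].
  have x0 : x != \bot by rewrite -(ranked_eq0 _ rr) rx.
  by exists (Sub x x0); rewrite ?SubK // /level/= /underline_rank SubK rx.
have : (0 < r (val x))%N by rewrite lt0n (ranked_eq0 _ rr) (valP x).
by rewrite /level/= -rx /underline_rank => /prednK.
Qed.

Lemma underline_graded (P : bPOrderType disp) (r : P -> nat) :
  ranked r -> graded (@underline_rank _ P r).
Proof.
move=> rr; have [_ cr mr fr] := rr.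
have rK (x : underline P) : (underline_rank r x).+1 = r (val x).
  by rewrite prednK // lt0n (ranked_eq0 _ rr) (valP x).
split=> [a b [ab nb]|a b ab|d].
- apply: succn_inj; rewrite !rK; apply: cr; split=> // c ac cb.
  (* An element strictly above another is not the bottom, so removing the bottom creates no new
     coverings. *)
  have c0 : c != \bot by apply: contraTneq ac => ->; rewrite ltx0.
  by apply: (nb (Sub c c0)); rewrite ltEsub SubK.
- by rewrite -ltnS !rK; apply: mr.
- have := fr d.+1; rewrite level_underline // (eq_finite_set (inj_card_eq _)) //.
  by move=> x y _ _; apply: val_inj.
Qed.

(** The new top covers exactly the maximal elements; their common rank [d] is what makes [d.+1] a
    consistent rank for it. *)
Lemma hat_graded (P : bPOrderType disp) (r : P -> nat) d : ranked r ->
  has_rank r d -> (forall x, maximal x -> r x = d) -> graded (@hat_rank _ P r d).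
Proof.
move=> [_ cr mr fr] [_ rd] maxr.
have ltSome (x y : P) : ((Some x : hat P) < Some y) = (x < y).
  by rewrite !lt_def.
split=> [[x|] [y|] [ab nb]|[x|] [y|]|e] //=.
- apply: cr; split=> [|c xc cy]; first by rewrite -ltSome.
  by apply: (nb (Some c)); rewrite ltSome.
- rewrite (maxr x) // => y; rewrite le_eqVlt => /orP[/eqP->//|xy].
  by case: (nb (Some y)); rewrite ?ltSome.
- by rewrite ltSome => /mr.
- by rewrite ltnS rd.
- apply: (sub_finite_set (B := (Some @` level r e) `|` [set None])).
    by move=> [x|]; [left; exists x|right].
  by rewrite finite_setU; split; [apply: finite_image|apply: finite_set1].
Qed.

End Ranks.

(** * When two points are identified in a wedge or a diamond *)

Section Gluing.
Variables (disp : Order.disp_t) (I : finType).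

Lemma dunion_in_comp_inj (P Q : I -> porderType disp) (k : forall i, P i -> Q i)
    i (x : P i) j (y : P j) : (forall i, injective (@k i)) ->
  dunion_in (k i x) = dunion_in (k j y) -> dunion_in x = dunion_in y.
Proof.
move=> injk e; have eij : i = j by have := congr1 tag e.
by move: y e; rewrite -eij => y /eqP; rewrite eq_Tagged => /eqP /= /injk ->.
Qed.

Lemma glue_in_label (P : I -> porderType disp) (lab : forall i, P i -> option bool)
    i (x : P i) j (y : P j) : lab i x <> None -> lab i x = lab j y ->
  glue_in lab x = glue_in lab y.
Proof.
move=> nx exy; apply/eqP; rewrite eqmodE /= /same_label /=; apply/orP; right.
by rewrite exy eqxx andbT -exy; apply/eqP.
Qed.

Lemma wedge_in_bot (P : I -> bPOrderType disp) i j :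
  glue_in (@wedge_label _ _ P) (\bot : P i) = glue_in (@wedge_label _ _ P) (\bot : P j).
Proof. by apply: (@glue_in_label P); rewrite /wedge_label !eqxx. Qed.

Lemma wedge_in_eq (P : I -> bPOrderType disp) i (x : P i) j (y : P j) :
  glue_in (@wedge_label _ _ P) x = glue_in (@wedge_label _ _ P) y ->
  dunion_in (P := P) x = dunion_in (P := P) y \/ x = \bot /\ y = \bot.
Proof. by move=> /(@glue_in_eq _ _ P)[|[nx e]]; [left|right; apply: wedge_labelE nx e]. Qed.

Lemma diamond_in_bot (P : I -> tbPOrderType disp) i j :
  glue_in (@diamond_label _ _ P) (\bot : P i) = glue_in (@diamond_label _ _ P) (\bot : P j).
Proof. by apply: (@glue_in_label P); rewrite /diamond_label !eqxx. Qed.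

Lemma diamond_in_eq (P : I -> tbPOrderType disp) i (x : P i) j (y : P j) :
  glue_in (@diamond_label _ _ P) x = glue_in (@diamond_label _ _ P) y ->
  [\/ dunion_in (P := P) x = dunion_in (P := P) y, x = \bot /\ y = \bot | x = \top /\ y = \top].
Proof.
move=> /(@glue_in_eq _ _ P)[|[nx e]]; first by constructor 1.
by case: (diamond_labelE nx e); [constructor 2|constructor 3].
Qed.

(** The label tests for [\bot] first, so a top carries [Some true] only if it differs from the
    bottom. *)
Lemma diamond_in_top (P : I -> tbPOrderType disp) i j :
  (\top : P i) != \bot -> (\top : P j) != \bot ->
  glue_in (@diamond_label _ _ P) (\top : P i) = glue_in (@diamond_label _ _ P) (\top : P j).
Proof.
by move=> /negPf ni /negPf nj; apply: (@glue_in_label P); rewrite /diamond_label ni ?nj !eqxx.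
Qed.

End Gluing.

(** * Disjoint unions against wedges *)

Section UnionWedge.
Variables (disp : Order.disp_t) (I : finType) (P : I -> bPOrderType disp).
Variable r : forall i, P i -> nat.
Arguments r : clear implicits.
Hypothesis rr : forall i, ranked (r i).

Lemma ranked_wedge_family :
  family_poset (T := wedge P) (@glue_in _ _ _ (@wedge_label _ _ P)) r (wedge_rank r).
Proof. by apply: wedge_family => i j; rewrite !ranked_bot. Qed.

Lemma wedge_graded : graded (wedge_rank r).
Proof.
by apply: family_graded ranked_wedge_family => i; apply: ranked_graded.
Qed.

Lemma wedge_bottom_level R : total_order R -> Macaulay_at R (wedge_rank r) 0.
Proof.
move=> totR; have [surf _ leE rE] := ranked_wedge_family.
apply: Macaulay_at_full => // [|u v]; first exact: wedge_graded.
have [i [x ->]] := surf u; have [j [y ->]] := surf v; rewrite !rE.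
move=> /eqP; rewrite ranked_eq0 // => /eqP -> _; rewrite (wedge_in_bot P i j).
by rewrite leE; apply/asboolP; exists j, \bot, y.
Qed.

Lemma wedge_bottom_rank u : wedge_rank r u = 0%N ->
  forall i, u = glue_in (@wedge_label _ _ P) (\bot : P i).
Proof.
have [surf _ _ rE] := ranked_wedge_family; have [i [x ->]] := surf u.
rewrite rE => /eqP; rewrite ranked_eq0 // => /eqP -> j; exact: wedge_in_bot.
Qed.

(** The union embeds in the wedge, missing only the glued bottom and raising ranks by one. Level 0
    of the wedge is covered by [wedge_bottom_level]; every other level is a transferred one. *)
Lemma underline_wedge_Macaulay :
  Macaulay (dunion_rank (P := fun i => underline (P i)) (fun i => underline_rank (r i)))
  <-> Macaulay (wedge_rank r).
Proof.
pose g (u : dunion (fun i => underline (P i))) : wedge P :=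
  glue_in (@wedge_label _ _ P) (val (tagged u)).
have gI : injective g.
  move=> [i x] [j y] /wedge_in_eq[|[x0]]; last by have := valP x; rewrite x0 eqxx.
  by move/(@dunion_in_comp_inj _ _ (fun i => underline (P i)) P (fun i => val)); apply;
    move=> l; apply: val_inj.
have match_levels d : levels_match (P := fun i => underline (P i)) (Q := P)
    (fun i => underline_rank (r i))
    (dunion_rank (P := fun i => underline (P i)) (fun i => underline_rank (r i)))
    r (fun i => val) g d d.+1.
  by split=> [x y _ _ /gI//|i]; apply: level_underline.
have transfer R R' d : (forall x y, R' (g x) (g y) = R x y) ->
    Macaulay_at R
      (dunion_rank (P := fun i => underline (P i)) (fun i => underline_rank (r i))) d <->
    Macaulay_at R' (wedge_rank r) d.+1.
  move=> RE; apply: (family_transfer (g := g) (dunion_family _) ranked_wedge_family _ _ _ _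
    (match_levels d) (match_levels d.+1)) => //.
  - by move=> i; apply: underline_graded.
  - by move=> i; apply: ranked_graded.
split=> [[R totR mac]|[R totR mac]].
  have [||R' totR' RE] := total_order_push (S := setT) totR (g := g).
  - by move=> x y _ _ /gI.
  - move=> u v nu nv; have out w : ~ (g @` setT) w -> wedge_rank r w = 0%N.
      have [surf _ _ rE] := ranked_wedge_family; have [i [x ->]] := surf w => nw.
      apply/eqP; rewrite rE ranked_eq0 //; apply/negP => /negP x0; apply: nw.
      by exists (@dunion_in _ _ (fun i => underline (P i)) i (Sub x x0)); rewrite ?/g ?SubK.
    (* This only produces an index [i] with which to name the glued bottom. *)
    have [i [x _]] := glue_inP u.
    by rewrite (wedge_bottom_rank (out _ nu) i) (wedge_bottom_rank (out _ nv) i).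
  exists R' => // -[|d]; first exact: wedge_bottom_level.
  by apply/(transfer R) => [x y|]; [apply: RE|apply: mac].
exists (fun x y => R (g x) (g y)); first exact: total_order_pull.
by move=> d; apply/(transfer _ R) => //; apply: mac.
Qed.

(** The bottoms, distinct in the union, collapse in the wedge, so [g] is injective only on positive
    ranks. The order is pushed from there, and only the glued bottom remains to be placed. *)
Lemma dunion_wedge_Macaulay :
  Macaulay (dunion_rank r) -> Macaulay (wedge_rank r).
Proof.
move=> [R totR mac].
pose g (u : dunion P) : wedge P := glue_in (@wedge_label _ _ P) (tagged u).
have famD : family_poset (@dunion_in _ _ P) r (dunion_rank r) by exact: dunion_family.
have [surf _ _ rE] := ranked_wedge_family.
have gI : set_inj [set u | dunion_rank r u <> 0%N] g.
  move=> [i x] [j y] /set_mem/= x0 _ /wedge_in_eq[//|[ex _]]; case: x0.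
  by move: ex => /= ->; apply: ranked_bot.
have [u v nu nv|R' totR' RE] := total_order_push totR gI.
  have out w : ~ (g @` [set u | dunion_rank r u <> 0%N]) w -> wedge_rank r w = 0%N.
    have [i [x ->]] := surf w => nw; rewrite rE; apply: contra_notP nw => x0.
    by exists (dunion_in x).
  have [i [x _]] := glue_inP u.
  by rewrite (wedge_bottom_rank (out _ nu) i) (wedge_bottom_rank (out _ nv) i).
exists R' => // -[|d]; first exact: wedge_bottom_level.
have match_levels e : levels_match (P := P) (Q := P) r (dunion_rank r) r (fun i x => x) g e.+1 e.+1.
  split=> [u v /set_mem/= ru /set_mem/= rv /gI|i]; last by rewrite image_id.
  by apply; apply/mem_set => /=; rewrite ?ru ?rv.
apply/(family_transfer (g := g) (R := R) famD ranked_wedge_family _ _ _ _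
  (match_levels d) (match_levels d.+1)) => //.
- by move=> i; apply: ranked_graded.
- by move=> i; apply: ranked_graded.
- by move=> x y /andP[rx _] /andP[ry _]; apply: RE => /= e; [move: rx|move: ry]; rewrite e.
exact: mac.
Qed.

End UnionWedge.

(** * Wedges against diamonds *)

Section WedgeDiamond.
Variables (disp : Order.disp_t) (I : finType).

(** Maps out of the wedge are defined on chosen representatives. The choice matters only for
    bottoms, which [k] sends to bottoms, and these are glued in the diamond as well. *)
Lemma wedge_to_diamondE (P : I -> bPOrderType disp) (Q : I -> tbPOrderType disp)
    (k : forall i, P i -> Q i) i (x : P i) : (forall i, k i \bot = \bot) ->
  let w := repr (glue_in (@wedge_label _ _ P) x) in
  glue_in (@diamond_label _ _ Q) (k _ (tagged w)) = glue_in (@diamond_label _ _ Q) (k i x).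
Proof.
move=> kb w; have : glue_in (@wedge_label _ _ P) (tagged w) = glue_in (@wedge_label _ _ P) x.
  by rewrite -[RHS]reprK /glue_in /w; case: (repr _).
case: w => j y /= /wedge_in_eq[e|[-> ->]]; last by rewrite !kb; apply: diamond_in_bot.
have eij : j = i by have := congr1 tag e.
by move: x e; rewrite -eij => x /eqP; rewrite eq_Tagged => /eqP /= ->.
Qed.

(** The wedge is the diamond without its top. Levels up to [d] match, so the condition transfers at
    each [e < d]; from [d] on, both sides satisfy it automatically. *)
Lemma wedge_hat_diamond_Macaulay (P : I -> bPOrderType disp) (r : forall i, P i -> nat) d :
  (forall i, ranked (r i)) -> (forall i, has_rank (r i) d) ->
  (forall i (x : P i), maximal x -> r i x = d) ->
  Macaulay (wedge_rank r) <->
  Macaulay (diamond_rank (P := fun i => hat (P i)) (fun i => hat_rank (r i) d)).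
Proof.
move=> rr rd rmax.
pose H i : tbPOrderType disp := hat (P i); pose s i : H i -> nat := hat_rank (r i) d.
change (Macaulay (wedge_rank r) <-> Macaulay (diamond_rank s)).
pose inH i (q : H i) := glue_in (@diamond_label _ _ H) q.
pose g (u : wedge P) : diamond H := inH _ (Some (tagged (repr u))).
have gE i (x : P i) : g (glue_in (@wedge_label _ _ P) x) = inH i (Some x).
  exact: (wedge_to_diamondE (Q := H) (k := fun i => Some)).
have famW := ranked_wedge_family rr; have [surW _ _ rE] := famW.
have famD : family_poset (T := diamond H) inH s (diamond_rank s).
  by apply: diamond_family => i j //=; rewrite !ranked_bot.
have [surD _ _ sE] := famD.
have gr i : graded (r i) by apply: ranked_graded; apply: rr.
have gs i : graded (s i) by apply: hat_graded => //; apply: rmax.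
have gW := family_graded gr famW; have gD := family_graded gs famD.
have gI : injective g.
  move=> u v; have [i [x ->]] := surW u; have [j [y ->]] := surW v; rewrite !gE.
  move=> /diamond_in_eq[e|[[->] [->]]|[]//]; last exact: wedge_in_bot.
  congr (\pi_(glue _)%qT _).
  by apply: (dunion_in_comp_inj (Q := H) (k := fun i => Some)) e => l a b [].
have match_levels e : (e <= d)%N ->
    levels_match (P := P) (Q := H) r (wedge_rank r) s (fun i => Some) g e e.
  move=> ed; split=> [x y _ _ /gI//|i]; apply/seteqP; split=> [[x|]|_ [x <- <-]] //.
    by exists x.
  by move=> de; move: ed; rewrite -de ltnn.
have transfer R R' e : (forall x y, R' (g x) (g y) = R x y) -> (e < d)%N ->
    Macaulay_at R (wedge_rank r) e <-> Macaulay_at R' (diamond_rank s) e.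
  move=> RE ed; apply: (family_transfer (g := g) famW famD gr gs _ _
    (match_levels e (ltnW ed)) (match_levels e.+1 ed)) => //.
have in_top i j : inH i None = inH j None.
  exact: (diamond_in_top (P := H)).
split=> [[R totR mac]|[R totR mac]].
  have [||R' totR' RE] := total_order_push (S := setT) totR (g := g).
  - by move=> x y _ _ /gI.
  - move=> u v; have out w : ~ (g @` setT) w -> exists i, w = inH i None.
      have [i [[x|] ->]] := surD w => nw; last by exists i.
      by case: nw; exists (glue_in (@wedge_label _ _ P) x).
    by move=> /out[i ->] /out[j ->].
  exists R' => // e; have [ed|de] := ltnP e d.
    by apply/(transfer R) => // [x y|]; [apply: RE|apply: mac].
  (* For [e >= d], only the added top can have rank [e.+1], and it lies above everything. *)
  apply: Macaulay_at_full => // u v.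
  have [i [x ->]] := surD u; have [j [[y|] ->]] := surD v; rewrite !sE.
    by move=> _ /= ry; have [_ /(_ y)] := rd j; rewrite ry ltnNge de.
  by move=> _ _; rewrite (in_top j i); apply: family_leW famD _; apply: hat_lex1.
exists (fun x y => R (g x) (g y)); first exact: total_order_pull.
move=> e; have [ed|de] := ltnP e d; first by apply/(transfer _ R) => //; apply: mac.
(* For [e >= d], level [e.+1] of the wedge is empty. *)
apply: Macaulay_at_full => // [|u v _]; first exact: total_order_pull.
have [j [y ->]] := surW v; rewrite rE => ry.
by have [_ /(_ y)] := rd j; rewrite ry ltnNge de.
Qed.

(** Dual to the passage from union to wedge: the tops, distinct in the wedge, collapse, so the order
    is pushed from the ranks other than [d] and only the glued top remains to be placed. *)
Lemma wedge_diamond_Macaulay (P : I -> tbPOrderType disp) (r : forall i, P i -> nat) d :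
  (forall i, ranked (r i)) -> (forall i, has_rank (r i) d) ->
  Macaulay (wedge_rank (P := P) r) -> Macaulay (diamond_rank r).
Proof.
move=> rr rd [R totR mac].
pose inD i (q : P i) := glue_in (@diamond_label _ _ P) q.
pose g (u : wedge P) : diamond P := inD _ (tagged (repr u)).
have gE i (x : P i) : g (glue_in (@wedge_label _ _ P) x) = inD i x.
  exact: (wedge_to_diamondE (P := P) (Q := P) (k := fun i x => x)).
have famW := ranked_wedge_family (P := P) rr; have [surW _ _ rE] := famW.
have famD : family_poset (T := diamond P) inD r (diamond_rank r).
  apply: diamond_family => i j; first by rewrite (ranked_bot (rr i)) (ranked_bot (rr j)).
  by rewrite !(has_rank_top (rr _) (rd _)).
have [surD _ _ sE] := famD.
have gr i : graded (r i) by apply: ranked_graded; apply: rr.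
have gD := family_graded gr famD.
have in_top i j : inD i \top = inD j \top.
  (* In rank 0 every poset is a single point, and the tops are identified as bottoms. *)
  have [d0|d0] := eqVneq d 0%N.
    have tb l : (\top : P l) = \bot.
      by apply/eqP; rewrite -(ranked_eq0 _ (rr l)) (has_rank_top (rr l) (rd l)) d0.
    by rewrite !tb; apply: diamond_in_bot.
  by apply: diamond_in_top; rewrite -(ranked_eq0 _ (rr _)) (has_rank_top (rr _) (rd _)).
have gI : set_inj [set u | wedge_rank (P := P) r u <> d] g.
  move=> u v /set_mem + _; have [i [x ->]] := surW u; have [j [y ->]] := surW v.
  rewrite !gE /= rE => rx /diamond_in_eq[e|[-> ->]|[xt _]].
  - by congr (\pi_(glue _)%qT _).
  - exact: wedge_in_bot.
  - by case: rx; rewrite xt; apply: has_rank_top.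
have [u v|R' totR' RE] := total_order_push totR gI.
  have out w : ~ (g @` [set u | wedge_rank (P := P) r u <> d]) w -> exists i, w = inD i \top.
    have [i [x ->]] := surD w => nw; exists i; congr (inD i _).
    apply/eqP; rewrite -(has_rank_eq_top _ (rr i) (rd i)); apply/eqP.
    apply: contra_notP nw => rx.
    by exists (glue_in (@wedge_label _ _ P) x); rewrite /= ?rE ?gE.
  by move=> /out[i ->] /out[j ->].
(* Transfer needs both levels [e] and [e.+1] strictly below the top. Otherwise an element of rank
   [e.+1] must have rank exactly [d], hence is the glued top, above everything. *)
exists R' => // e; have [ed|de] := ltnP e.+1 d; last first.
  apply: Macaulay_at_full => // u v.
  have [i [x ->]] := surD u; have [j [y ->]] := surD v; rewrite !sE => _ ry.
  have ryd : r j y = d.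
    by have [_ /(_ y)] := rd j; rewrite ry => ?; apply/eqP; rewrite eqn_leq de andbT.
  move: ryd => /eqP; rewrite has_rank_eq_top // => /eqP ->.
  by rewrite (in_top j i); apply: family_leW famD _; apply: lex1.
have match_levels l : (l < d)%N ->
    levels_match (P := P) (Q := P) r (wedge_rank (P := P) r) r (fun i x => x) g l l.
  move=> ld; split=> [u v /set_mem/= ru /set_mem/= rv /gI|i]; last by rewrite image_id.
  by apply; apply/mem_set => /= e'; move: ld; rewrite -e' ?ru ?rv ltnn.
apply/(family_transfer (g := g) (R := R) famW famD gr gr _ gE
  (match_levels e (ltnW ed)) (match_levels e.+1 ed)); last exact: mac.
  by [].
by move=> x y /andP[_ rx] /andP[_ ry]; apply: RE => /= e';
  [move: rx|move: ry]; rewrite e' leqNgt ed.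
Qed.

End WedgeDiamond.

Theorem theorem4p4 :
  (forall (disp : Order.disp_t) (n : nat) (P : 'I_n -> bPOrderType disp)
      (r : forall i : 'I_n, P i -> nat),
    (forall i : 'I_n, ranked (r i)) ->
    (Macaulay (dunion_rank (P := fun i => underline (P i))
                           (fun i => underline_rank (r i))) <->
     Macaulay (wedge_rank (P := P) r)) /\
    (forall d : nat,
      (forall i : 'I_n, has_rank (r i) d) ->
      (forall (i : 'I_n) (x : P i), maximal x -> r i x = d) ->
      (Macaulay (wedge_rank (P := P) r) <->
       Macaulay (diamond_rank (P := fun i => hat (P i))
                              (fun i => hat_rank (r i) d))))) /\
  (forall (disp : Order.disp_t) (n : nat) (P : 'I_n -> bPOrderType disp)
      (r : forall i : 'I_n, P i -> nat),
    (forall i : 'I_n, ranked (r i)) ->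
    Macaulay (dunion_rank (P := P) r) -> Macaulay (wedge_rank (P := P) r)) /\
  (forall (disp : Order.disp_t) (n : nat) (P : 'I_n -> tbPOrderType disp)
      (r : forall i : 'I_n, P i -> nat) (d : nat),
    (forall i : 'I_n, ranked (r i)) ->
    (forall i : 'I_n, has_rank (r i) d) ->
    Macaulay (wedge_rank (P := P) r) -> Macaulay (diamond_rank (P := P) r)).
Proof.
split=> [disp n P r rr|].
  split=> [|d rd rmax]; first exact: underline_wedge_Macaulay.
  exact: wedge_hat_diamond_Macaulay.
split=> [disp n P r rr|disp n P r d rr rd]; first exact: dunion_wedge_Macaulay.
exact: (wedge_diamond_Macaulay rr rd).
Qed.
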